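(* Let $G=(V,E)$ be a graph. Then $\mathrm{Circ}(G)$ is linearly independent if and only if, for every circuit $c\in\mathrm{Circ}(G)$, there exists an edge $e$ of $c$ such that no other circuit of $G$ has $e$ as an edge.
   Context: A graph is a pair $G=(V,E)$ with $V$ a finite set and $E\subseteq V\times V$ such that for each $v\in V$ there are edges $(u_1,v),(v,u_2)\in E$ (a finite directed graph). A circuit of $G$ is a closed walk $(v_0,\dots,v_l)$, $l\ge1$, $(v_i,v_{i+1})\in E$, $v_0=v_l$, with $v_0,\dots,v_{l-1}$ pairwise distinct, regarded as a subgraph $c$ with $l$ vertices and edge set $E(c)$ of $l$ edges (so cyclic rotations are identified); $\mathrm{Circ}(G)$ is the set of all circuits of $G$. A circuit $c$ is identified with the vector $\sum_{e\in E(c)}e$ in the real vector space with basis $E$, and linear independence is understood there. *)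

(* Defs.v *)
From HB Require Import structures.
From mathcomp Require Import all_boot all_order all_algebra.
From mathcomp Require Import boolp reals.

Set Implicit Arguments.
Unset Strict Implicit.
Unset Printing Implicit Defensive.

Import Order.TTheory GRing.Theory Num.Theory.

Local Open Scope ring_scope.

Record digraph := Digraph {
  vertex :> finType;
  arcs : {set vertex * vertex};
  has_pred : forall v : vertex, exists u : vertex, (u, v) \in arcs;
  has_succ : forall v : vertex, exists u : vertex, (v, u) \in arcs
}.

Definition edge (G : digraph) : finType := {e : G * G | e \in arcs G}.

Definition subgraph (G : digraph) : finType := ({set G} * {set edge G})%type.

Definition sg_vertices (G : digraph) (c : subgraph G) : {set G} := c.1.
Definition sg_edges (G : digraph) (c : subgraph G) : {set edge G} := c.2.

(* The sequence s = (v_0, ..., v_(l-1)) stands for the walk (v_0, ..., v_l)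
   with v_l = v_0; [next s] is the cyclic successor, so that the edges
   (v_i, v_(i+1)) are the pairs (v, next s v) for v in s.  The case l = 1 is
   a loop. *)
Definition circuit_walk (G : digraph) (s : seq G) : Prop :=
  [/\ (0 < size s)%N, uniq s & cycle (fun u v => (u, v) \in arcs G) s].

Definition walk_subgraph (G : digraph) (s : seq G) : subgraph G :=
  ([set v in s],
   [set e : edge G | ((val e).1 \in s) && ((val e).2 == next s (val e).1)]).

Definition is_circuit (G : digraph) (c : subgraph G) : Prop :=
  exists2 s : seq G, circuit_walk s & c = walk_subgraph s.

Definition Circ (G : digraph) : {set subgraph G} := [set c | `[< is_circuit c >]].

(* The free vector space on E is realised as the functions E -> R. *)
Definition edge_space (R : realType) (G : digraph) : vectType R :=
  {ffun edge G -> R^o}.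

Definition edge_vec (R : realType) (G : digraph) (e : edge G) : edge_space R G :=
  [ffun e' : edge G => (e' == e)%:R : R^o].

Definition circuit_vec (R : realType) (G : digraph) (c : subgraph G) :
    edge_space R G :=
  \sum_(e in sg_edges c) edge_vec R e.

(* Main.v *)
Require Import Defs.
From mathcomp Require Import all_boot all_order all_algebra.
From mathcomp Require Import boolp reals.

(** If every circuit owns a private edge, reading a linear relation between
    circuits at the private edge of [c] shows that the coefficient of [c]
    vanishes ([private_edges_free]).

    Conversely, suppose that every edge of the circuit [c] lies on some other
    circuit, and let [S] be the sum of all circuits except [c].  Every edge of
    [c] has weight at least one in [S], so [S - c] is still a nonnegative
    integral flow that is conserved at each vertex.  Such a flow is a sum of
    circuits ([balanced_sum_circuits]): follow edges of positive weight, which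
    conservation always permits, until a vertex repeats; subtract the circuit
    found and iterate.  Hence [S = c + (a sum of circuits)] writes one vector
    as two combinations of circuits, the coefficient of [c] being zero on the
    left and positive on the right, which contradicts independence
    ([free_private_edge]). *)

Set Implicit Arguments.
Unset Strict Implicit.
Unset Printing Implicit Defensive.

Import GRing.Theory Num.Theory.

(** Coefficients are indexed by the elements of [A] rather than by positions in
    the list, so that a value of [f] taken twice counts as a dependence. *)
Lemma free_imageP (K : fieldType) (vT : vectType K) (T : finType)
    (A : {set T}) (f : T -> vT) :
  free [seq f x | x in A] <->
  (forall k : T -> K, (\sum_(x in A) k x *: f x = 0)%R ->
     forall x, x \in A -> k x = 0%R).
Proof.
pose X : #|A|.-tuple vT := [tuple of [seq f x | x in A]].
have XE (i : 'I_#|A|) : nth 0%R X i = f (enum_val i) by exact: nth_image.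
split=> [/(@freeP _ _ _ X) freeX k k0 x xA | indep].
  have k0' : (\sum_(i < #|A|) k (enum_val i) *: nth 0 X i = 0)%R.
    rewrite -[RHS]k0 [RHS]big_enum_val.
    by apply: eq_bigr => i _; rewrite XE.
  have := freeX _ k0' (enum_rank_in xA x).
  by rewrite enum_rankK_in.
apply/(@freeP _ _ _ X) => k k0 i.
have iA := enum_valP i.
pose k' x := k (enum_rank_in iA x).
have <- : k' (enum_val i) = k i by rewrite /k' enum_valK_in.
apply: indep => //; rewrite -[RHS]k0 [LHS]big_enum_val.
by apply: eq_bigr => j _; rewrite XE /k' enum_valK_in.
Qed.

Section Circuits.

Variable G : digraph.
Implicit Types (s : seq G) (c d : subgraph G) (e : edge G) (x : edge G -> nat).

Lemma CircP c : reflect (is_circuit c) (c \in Circ G).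
Proof. by rewrite inE; apply: asboolP. Qed.

(** * Circuits as flows *)

(** The edges of the walk correspond to its vertices through [v |-> (v, next s v)];
    counting edges by tail or by head thus becomes counting vertices. *)
Lemma sum_walk_edges s (F : G * G -> nat) : circuit_walk s ->
  \sum_(e in sg_edges (walk_subgraph s)) F (val e) =
  \sum_(v in s) F (v, next s v).
Proof.
case=> _ _ cyc_s.
rewrite -(big_imset F (in2W val_inj)) /=.
rewrite -(@big_imset _ _ _ _ _ (fun v => (v, next s v)) (mem s) F) /=; last first.
  by move=> u v _ _ [].
apply: eq_bigl => p; apply/imsetP/imsetP => [[e] | [v v_s ->]].
  rewrite inE => /andP[e1s /eqP e2] ->; exists (val e).1 => //.
  by rewrite -e2; rewrite -surjective_pairing.
exists (Sub (v, next s v) (next_cycle cyc_s v_s)); last by rewrite SubK.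
by rewrite inE SubK /= eqxx andbT.
Qed.

Definition balanced x :=
  forall v, \sum_(e | (val e).1 == v) x e = \sum_(e | (val e).2 == v) x e.

Lemma balanced_sum (I : finType) (P : pred I) (F : I -> edge G -> nat) :
  (forall i, P i -> balanced (F i)) ->
  balanced (fun e => \sum_(i | P i) F i e).
Proof.
move=> balF v; rewrite exchange_big [RHS]exchange_big /=.
by apply: eq_bigr => i /balF /(_ v).
Qed.

Lemma balanced_sub x y : (forall e, y e <= x e) ->
  balanced x -> balanced y -> balanced (fun e => x e - y e).
Proof.
by move=> le_yx balx baly v; rewrite !sumnB ?balx ?baly // => e _.
Qed.

Lemma balanced_circuit c : c \in Circ G ->
  balanced (fun e => e \in sg_edges c).
Proof.
case/CircP=> s walk_s -> v.
have sumE (b : G * G -> bool) :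
    \sum_(e | b (val e)) (e \in sg_edges (walk_subgraph s)) =
    \sum_(u in s) b (u, next s u).
  rewrite -(@sum_walk_edges s (fun p => nat_of_bool (b p))) //.
  rewrite [LHS]big_mkcond [RHS]big_mkcond /=; apply: eq_bigr => e _.
  by case: (b _); case: (_ \in _).
case: (walk_s) => _ uniq_s _.
rewrite (sumE (fun p => p.1 == v)) (sumE (fun p => p.2 == v)) /=.
(* The cyclic successor permutes the vertices of the walk. *)
rewrite (reindex_inj (can_inj (prev_next uniq_s))) /=.
by apply: eq_bigl => u; rewrite mem_next.
Qed.

(** * Decomposing a flow into circuits *)

(** Conservation lets a walk that entered a vertex along an edge of positive
    weight leave it along another one; as the graph is finite, iterating one
    fixed choice of such an exit eventually runs through a circuit. *)
Lemma balanced_has_circuit x e0 : balanced x -> 0 < x e0 ->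
  exists2 c, c \in Circ G & forall e, e \in sg_edges c -> 0 < x e.
Proof.
move=> balx x0.
pose entered v := [exists e, ((val e).2 == v) && (0 < x e)].
have exits v : entered v -> exists e, ((val e).1 == v) && (0 < x e).
  case/existsP=> e /andP[e2v xe]; apply/existsP; apply: contraLR xe.
  rewrite negb_exists -eqn0Ngt => /forallP no_exit.
  have : \sum_(e | (val e).2 == v) x e == 0.
    rewrite -balx big1 // => e' e'1v; have := no_exit e'.
    by rewrite e'1v -eqn0Ngt => /eqP.
  by rewrite sum_nat_eq0 => /forallP/(_ e)/implyP; apply.
pose f v := if [pick e | ((val e).1 == v) && (0 < x e)] is Some e
            then (val e).2 else v.
have fE v : entered v -> exists2 e, val e = (v, f v) & 0 < x e.
  move=> /exits[e1 e1v]; rewrite /f; case: pickP => [e /andP[/eqP <- xe] | no].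
    by exists e => //; case: (val e).
  by rewrite no in e1v.
have entered_f v : entered v -> entered (f v).
  by move=> /fE[e ve xe]; apply/existsP; exists e; rewrite ve eqxx xe.
have entered_iter n v : entered v -> entered (iter n f v).
  by move=> v_in; elim: n => //= n; apply: entered_f.
have [y y_in cyc_y] : exists2 y, entered y & fcycle f (orbit f y).
  set u := (val e0).2.
  have u_in : entered u by apply/existsP; exists e0; rewrite eqxx.
  have /trajectP[i lt_i def_i] := looping_order f u.
  exists (iter i f u); first exact: entered_iter.
  apply/(orbitPcycle 0 3); exists (order f u - i).-1.
  by rewrite prednK ?subn_gt0 // -iterD subnK // ltnW.
have orbit_in v : v \in orbit f y -> entered v.
  by case/trajectP=> i _ ->; apply: entered_iter.
exists (walk_subgraph (orbit f y)).
  apply/CircP; exists (orbit f y) => //; split.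
  - by rewrite size_orbit order_gt0.
  - exact: orbit_uniq.
  apply: (@sub_in_cycle _ entered) cyc_y; last exact/allP.
  by move=> v w /fE[e ve _] _ /eqP <-; rewrite -ve; apply: valP.
move=> e; rewrite inE => /andP[e1 /eqP e2].
have [e' ve' xe'] := fE _ (orbit_in _ e1).
suff -> : e = e' by [].
apply: val_inj; rewrite ve' [LHS]surjective_pairing e2.
by rewrite (eqP (next_cycle cyc_y e1)).
Qed.

(** Subtracting a circuit from the support keeps the flow balanced and
    nonnegative and lowers its total weight, on which the induction runs. *)
Lemma balanced_sum_circuits x : balanced x ->
  exists n : subgraph G -> nat,
    forall e, x e = \sum_(d in Circ G) n d * (e \in sg_edges d).
Proof.
have [m le_m] := ubnP (\sum_e x e); elim: m => // m IHm in x le_m *.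
move=> balx; have [/existsP[e0 x0] | no_e] := boolP [exists e, 0 < x e]; last first.
  exists (fun=> 0) => e; rewrite big1 //; apply/eqP; rewrite eqn0Ngt.
  by apply: contra no_e => xe; apply/existsP; exists e.
have [c cC pos_c] := balanced_has_circuit balx x0.
have le_cx e : (e \in sg_edges c) <= x e.
  by case: (boolP (e \in sg_edges c)) => // /pos_c.
have [e1 e1c] : exists e, e \in sg_edges c.
  case/CircP: cC => -[|v s] [// _ _ cyc] ->.
  exists (Sub (v, next (v :: s) v) (next_cycle cyc (mem_head v s))).
  by rewrite inE SubK mem_head /=.
have [||n nE] := IHm (fun e => x e - (e \in sg_edges c)).
- rewrite sumnB => [|e _ //]; rewrite (leq_trans _ (ltnSE le_m)) //.
  have pos1 : 0 < \sum_e (e \in sg_edges c) by rewrite (bigD1 e1) //= e1c.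
  have le_sum : \sum_e (e \in sg_edges c) <= \sum_e x e by apply: leq_sum.
  by rewrite ltn_subrL pos1 (leq_trans pos1).
- exact/balanced_sub/balanced_circuit.
exists (fun d => n d + (d == c)) => e.
rewrite -[LHS](subnK (le_cx e)) nE.
under [RHS]eq_bigr do rewrite mulnDl.
rewrite big_split /=; congr (_ + _).
rewrite (bigD1 c) //= eqxx mul1n big1 ?addn0 // => d /andP[_ /negPf ->].
by rewrite mul0n.
Qed.

(** * Linear independence *)

Variable R : realType.

Lemma circuit_vecE c e : circuit_vec R c e = (e \in sg_edges c)%:R%R.
Proof.
rewrite /circuit_vec sum_ffunE.
under eq_bigr do rewrite ffunE.
have [e_c | e_c] := boolP (e \in sg_edges c); last first.
  by rewrite big1 // => e' e'c; case: eqP e_c => // ->; rewrite e'c.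
rewrite (bigD1 e) //= eqxx big1 ?addr0 // => e' /andP[_ /negPf].
by rewrite eq_sym => ->.
Qed.

Lemma circuit_combE (k : subgraph G -> R) e :
  ((\sum_(d in Circ G) k d *: circuit_vec R d)%R : edge_space R G) e =
  (\sum_(d in Circ G) k d * (e \in sg_edges d)%:R)%R.
Proof.
by rewrite sum_ffunE; apply: eq_bigr => d _; rewrite ffunE circuit_vecE.
Qed.

Lemma free_circuits_coef_inj (m n : subgraph G -> nat) :
  free [seq circuit_vec R c | c in Circ G] ->
  (forall e, \sum_(d in Circ G) m d * (e \in sg_edges d) =
             \sum_(d in Circ G) n d * (e \in sg_edges d)) ->
  {in Circ G, m =1 n}.
Proof.
move=> /free_imageP indep eq_mn c cC.
have /indep/(_ c cC)/eqP :
    (\sum_(d in Circ G) ((m d)%:R - (n d)%:R) *: circuit_vec R d = 0)%R.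
  apply/ffunP => e; rewrite circuit_combE ffunE.
  under eq_bigr do rewrite mulrBl -!natrM.
  by rewrite sumrB -!natr_sum eq_mn subrr.
by rewrite subr_eq0 eqr_nat => /eqP.
Qed.

(** At the private edge of [c], a combination of circuits takes as value the
    coefficient of [c]. *)
Lemma private_edges_free :
  (forall c, c \in Circ G -> exists e, e \in sg_edges c /\
     forall d, d \in Circ G -> d <> c -> e \notin sg_edges d) ->
  free [seq circuit_vec R c | c in Circ G].
Proof.
move=> priv; apply/free_imageP => k /ffunP k0 c cC.
have [e [e_c e_priv]] := priv c cC.
have := k0 e; rewrite circuit_combE ffunE (bigD1 c) //= e_c mulr1.
rewrite big1 ?addr0 // => d /andP[dC /eqP/(e_priv d dC)/negPf ->].
by rewrite mulr0.
Qed.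

(** Without a private edge on [c], the flow [S] below dominates [c], and
    [S = c + (S - c)] is a second way to combine circuits into [S]. *)
Lemma free_private_edge c :
  free [seq circuit_vec R c | c in Circ G] -> c \in Circ G ->
  exists e, e \in sg_edges c /\
    forall d, d \in Circ G -> d <> c -> e \notin sg_edges d.
Proof.
move=> indep cC; apply: contrapT => no_priv.
pose S e := \sum_(d in Circ G | d != c) (e \in sg_edges d).
have le_cS e : (e \in sg_edges c) <= S e.
  have [e_c | //] := boolP (e \in sg_edges c).
  rewrite lt0n; apply/negP; rewrite sum_nat_eq0 => /forallP S0.
  apply: no_priv; exists e; split=> // d dC /eqP d_c.
  by have := S0 d; rewrite dC d_c eqb0.
have balS : balanced S.
  by apply: balanced_sum => d /andP[dC _]; exact: balanced_circuit.
have [n nE] := balanced_sum_circuits (balanced_sub le_cS balS (balanced_circuit cC)).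
suff eq_coef e :
    \sum_(d in Circ G) (d != c) * (e \in sg_edges d) =
    \sum_(d in Circ G) ((d == c) + n d) * (e \in sg_edges d).
  by have := free_circuits_coef_inj indep eq_coef cC; rewrite eqxx.
under [RHS]eq_bigr do rewrite mulnDl.
rewrite big_split /= -nE [X in _ = X + _](bigD1 c) //= eqxx mul1n.
rewrite [X in _ = _ + X + _]big1 => [|d /andP[_ /negPf ->] //].
rewrite addn0 subnKC // /S big_mkcondr /=.
by apply: eq_bigr => d _; case: eqP; rewrite ?mul1n.
Qed.

End Circuits.

Theorem theorem5p2 (R : realType) (G : digraph) :
  free [seq circuit_vec R c | c in Circ G]
  <->
  (forall c : subgraph G, c \in Circ G ->
     exists e : edge G,
       e \in sg_edges c /\
       (forall c' : subgraph G, c' \in Circ G -> c' <> c ->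
          e \notin sg_edges c')).
Proof.
split; last exact: private_edges_free.
by move=> indep c; apply: free_private_edge indep.
Qed.
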